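(* For any integer $k\geq 1$, let $\mathcal{G}_k$ be the class of triangle-free graphs with treedepth at most $k$. Then the chromatic number, the defective chromatic number and the clustered chromatic number of $\mathcal{G}_k$ are equal, and their common value is at least $(1-o(1))\sqrt{2k}$ and at most $\left\lceil\frac{k+2}{2}\right\rceil$, where $o(1)$ denotes a quantity tending to $0$ as $k\to\infty$.
   Context: Graphs are finite, simple and undirected. A $k$-colouring of a graph assigns one of at most $k$ colours to each vertex (not necessarily properly). A monochromatic component is a connected component of the subgraph induced by all vertices of a single colour. A colouring has defect $d$ if every monochromatic component has maximum degree at most $d$, and has clustering $c$ if every monochromatic component has at most $c$ vertices. For a graph class $\mathcal{G}$: the chromatic number of $\mathcal{G}$ is $\max\{\chi(G):G\in\mathcal{G}\}$, where $\chi(G)$ is the usual (proper) chromatic number; the defective chromatic number of $\mathcal{G}$ is the minimum integer $k$ for which there exists an integer $d$ such that every graph in $\mathcal{G}$ is $k$-colourable with defect $d$; the clustered chromatic number of $\mathcal{G}$ is the minimum integer $k$ for which there exists an integer $c$ such that every graph in $\mathcal{G}$ is $k$-colourable with clustering $c$. (Each is called unbounded if the relevant maximum or minimum does not exist.) In a rooted tree, the depth of a vertex $v$ is the number of vertices on the path from the root to $v$; the depth of a rooted forest is the maximum depth of its vertices; the closure of a rooted forest $F$ is the graph on $V(F)$ in which two distinct vertices are adjacent if and only if one is an ancestor of the other. The treedepth of a graph $G$ is the minimum depth of a rooted forest $F$ such that $G$ is a spanning subgraph of the closure of $F$. *)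

(* Defs.v *)
From mathcomp Require Import all_boot.

Set Implicit Arguments.
Unset Strict Implicit.
Unset Printing Implicit Defensive.

Record sgraph := SGraph {
  vertex :> finType;
  adj : rel vertex;
  adj_sym : symmetric adj;
  adj_irr : irreflexive adj
}.

Definition triangle_free (G : sgraph) : Prop :=
  forall x y z : G, ~ [/\ adj x y, adj y z & adj x z].

(** ** Colourings *)

Section Colourings.

Variable G : sgraph.

Definition induced_adj (S : {set G}) : rel G :=
  [rel x y | [&& x \in S, y \in S & adj x y]].

(** Vertex sets of the connected components of the induced subgraph [G[S]]. *)
Definition components (S : {set G}) : {set {set G}} :=
  equivalence_partition (connect (induced_adj S)) S.

(** Maximum degree of the induced subgraph [G[S]]. *)
Definition max_degree (S : {set G}) : nat :=
  \max_(x in S) #|[set y in S | adj x y]|.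

Section Colouring.

Variables (k : nat) (f : {ffun G -> 'I_k}).

Definition proper : bool := [forall x, forall y, adj x y ==> (f x != f y)].

Definition colour_class (i : 'I_k) : {set G} := [set x | f x == i].

Definition mono_component (C : {set G}) : Prop :=
  exists i : 'I_k, C \in components (colour_class i).

Definition has_defect (d : nat) : Prop :=
  forall C, mono_component C -> max_degree C <= d.

Definition has_clustering (c : nat) : Prop :=
  forall C, mono_component C -> #|C| <= c.

End Colouring.

Definition colourable (k : nat) : bool :=
  [exists f : {ffun G -> 'I_k}, proper f].

Lemma colourable_ex : exists k, colourable k.
Proof.
exists #|G|; apply/existsP; exists [ffun x => enum_rank x].
apply/forallP=> x; apply/forallP=> y; apply/implyP=> xy.
rewrite !ffunE; apply: contraTneq xy => /enum_rank_inj ->.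
by rewrite adj_irr.
Qed.

Definition chi : nat := ex_minn colourable_ex.

End Colourings.

(** ** Rooted forests and treedepth *)

Section Forests.

Variable V : finType.

(** A rooted forest on [V] is encoded by its parent map, in which every root
    is its own parent: the roots are exactly the fixed points, and a map is a
    rooted forest iff iterating it from any vertex reaches a fixed point
    (i.e. there are no other cycles). *)
Definition rooted_forest (p : {ffun V -> V}) : bool :=
  [forall x, [exists r, fconnect p x r && (p r == r)]].

(** [ancestor p u v]: [u] lies on the path from [v] to its root ([u = v] is
    allowed). *)
Definition ancestor (p : {ffun V -> V}) (u v : V) : bool := fconnect p v u.

(** The path from [v] to its root is the orbit of [v] under the parent map. *)
Definition vertex_depth (p : {ffun V -> V}) (v : V) : nat := order p v.

Definition forest_depth (p : {ffun V -> V}) : nat :=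
  \max_(v : V) vertex_depth p v.

Definition forest_closure (p : {ffun V -> V}) : rel V :=
  [rel u v | (u != v) && (ancestor p u v || ancestor p v u)].

End Forests.

Section Treedepth.

Variable G : sgraph.

Definition elimination_forest (p : {ffun G -> G}) : bool :=
  rooted_forest p &&
  [forall x, forall y, adj x y ==> forest_closure p x y].

Definition has_forest_of_depth (k : nat) : bool :=
  [exists p : {ffun G -> G}, elimination_forest p && (forest_depth p == k)].

Lemma has_forest_of_depth_ex : exists k, has_forest_of_depth k.
Proof.
pose p := [ffun x : G =>
  enum_val (Ordinal (leq_ltn_trans (leq_pred _) (ltn_ord (enum_rank x))))].
have pE x : enum_rank (p x) = (enum_rank x).-1 :> nat.
  by rewrite ffunE enum_valK.
have itE n x : enum_rank (iter n p x) = enum_rank x - n :> nat.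
  by elim: n => [|n IHn]; rewrite ?subn0 //= pE IHn subnS.
have pP x y : enum_rank y <= enum_rank x -> fconnect p x y.
  move=> le_yx; suff <-: iter (enum_rank x - enum_rank y) p x = y.
    exact: fconnect_iter.
  by apply/enum_rank_inj/val_inj; rewrite /= itE subKn.
exists (forest_depth p); apply/existsP; exists p; rewrite eqxx andbT.
apply/andP; split.
  apply/forallP=> x; apply/existsP; exists (iter (enum_rank x) p x).
  rewrite fconnect_iter /=; apply/eqP/enum_rank_inj/val_inj.
  by rewrite /= pE itE subnn.
apply/forallP=> x; apply/forallP=> y; apply/implyP=> xy /=.
apply/andP; split.
  by apply: contraTneq xy => ->; rewrite adj_irr.
apply/orP; case: (leqP (enum_rank x) (enum_rank y)) => [|/ltnW] /pP.
  by left.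
by right.
Qed.

Definition treedepth : nat := ex_minn has_forest_of_depth_ex.

End Treedepth.

(** ** Graph classes *)

Definition graph_class := sgraph -> Prop.

Definition is_minimum (P : nat -> Prop) (n : nat) : Prop :=
  P n /\ forall m, P m -> n <= m.

Definition is_maximum (P : nat -> Prop) (n : nat) : Prop :=
  P n /\ forall m, P m -> m <= n.

Definition is_chromatic_number (C : graph_class) (n : nat) : Prop :=
  is_maximum (fun m => exists G : sgraph, C G /\ chi G = m) n.

Definition is_defective_chromatic_number (C : graph_class) (n : nat) : Prop :=
  is_minimum (fun k => exists d : nat, forall G : sgraph, C G ->
    exists f : {ffun G -> 'I_k}, has_defect f d) n.

Definition is_clustered_chromatic_number (C : graph_class) (n : nat) : Prop :=
  is_minimum (fun k => exists c : nat, forall G : sgraph, C G ->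
    exists f : {ffun G -> 'I_k}, has_clustering f c) n.

Definition triangle_free_treedepth (k : nat) : graph_class :=
  fun G => triangle_free G /\ treedepth G <= k.

(* Main.v *)
(* All three numbers equal the chromatic number of one universal graph of the
   class: its vertices are the words of length at most [k] whose letters record
   which earlier letters they are linked to, so colouring it amounts to colouring
   on-line, vertex by vertex, any triangle-free graph on [k] vertices.

   Repeating every letter sufficiently often, a colouring with bounded defect is
   proper on some copy of the universal graph: among many copies of a vertex over
   the same ancestors, one shares its colour with none of its upper neighbours.
   Hence neither defect nor clustering saves colours.

   For the upper bound, first-fit on-line colouring needs [2 m - 2] vertices to
   use [m] colours. For the lower bound, an adversary turns an independent set
   with [m] colours into one with [m + 1] colours by presenting at most [m + 1]
   vertices, so [m (m + 1) / 2] vertices force [m] colours. *)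

From mathcomp Require Import all_classical all_reals all_analysis.
From mathcomp Require Import all_boot all_order all_algebra.
Require Import Defs.
Import Order.TTheory GRing.Theory Num.Theory.
Import numFieldNormedType.Exports.

Set Implicit Arguments.
Unset Strict Implicit.
Unset Printing Implicit Defensive.

(** * Colourings and elimination forests *)

Section ColouringFacts.

Variables (G : sgraph) (q : nat).
Implicit Type f : {ffun G -> 'I_q}.

Lemma proper_colouringP f : reflect (forall x y, adj x y -> f x != f y) (proper f).
Proof.
apply: (iffP forallP) => [fP x y xy | fP x].
  by have /forallP/(_ y)/implyP/(_ xy) := fP x.
by apply/forallP=> y; apply/implyP/fP.
Qed.

Lemma induced_connect_equiv (S : {set G}) :
  {in S & &, equivalence_rel (connect (induced_adj S))}.
Proof.
have induced_sym : connect_sym (induced_adj S).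
  by apply: sym_connect_sym => x y; rewrite /induced_adj /= adj_sym andbCA.
by move=> x y z _ _ _; split=> [|xy]; rewrite ?connect0 // (same_connect _ xy).
Qed.

Lemma components_partition (S : {set G}) : partition (components S) S.
Proof. exact/equivalence_partitionP/induced_connect_equiv. Qed.

Lemma component_connect (S C : {set G}) : C \in components S ->
  {in C &, forall x y, [/\ x \in S, y \in S & connect (induced_adj S) x y]}.
Proof.
move=> CP x y xC yC.
have /and3P[/eqP covP trivP _] := components_partition S.
have CS z : z \in C -> z \in S by rewrite -covP => zC; apply/bigcupP; exists C.
split; [exact: CS | exact: CS |].
rewrite -(pblock_equivalence_partition (@induced_connect_equiv S)) ?CS //.
by rewrite -/(components S) (def_pblock trivP CP xC).
Qed.

Lemma proper_clustering f : proper f -> has_clustering f 1.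
Proof.
move=> /proper_colouringP fP C [i CP]; rewrite leqNgt.
apply/negP=> /card_gt1P[x [y [xC yC neq_xy]]].
have [_ _ /connectP[[|z p] /= pP yE]] := component_connect CP xC yC.
  by rewrite yE eqxx in neq_xy.
move: pP; rewrite /induced_adj /= !inE => /andP[/and3P[/eqP fx /eqP fz xz] _].
by have := fP _ _ xz; rewrite fx fz eqxx.
Qed.

Lemma clustering_defect f c : has_clustering f c -> has_defect f c.
Proof.
move=> fP C CP; apply: leq_trans (fP C CP); apply/bigmax_leqP=> x _.
by apply/subset_leq_card/subsetP=> y; rewrite inE => /andP[].
Qed.

(** The neighbours of [x] that share its colour lie in the monochromatic component of [x], so the
    bound on components becomes a bound at each vertex. *)
Lemma defect_neighbours f d : has_defect f d ->
  forall x, #|[set y | adj x y && (f y == f x)]| <= d.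
Proof.
move=> fP x; set S := colour_class f (f x); set C := pblock (components S) x.
have [/eqP covP trivP _] := and3P (components_partition S).
have xS : x \in S by rewrite inE.
have CP : C \in components S by rewrite pblock_mem ?covP.
have xC : x \in C by rewrite mem_pblock covP.
have /fP: mono_component f C by exists (f x).
apply: leq_trans.
rewrite /max_degree (bigD1 x) //= leq_max; apply/orP; left.
apply/subset_leq_card/subsetP=> y; rewrite !inE => /andP[xy fy].
rewrite xy andbT pblock_equivalence_partition ?inE //.
  by apply: connect1; rewrite /induced_adj /= !inE eqxx fy.
exact: induced_connect_equiv.
Qed.

End ColouringFacts.

Lemma chi_colouring (G : sgraph) : exists f : {ffun G -> 'I_(chi G)}, proper f.
Proof. by rewrite /chi; case: ex_minnP => n /existsP. Qed.

Lemma chi_le (G : sgraph) q (f : {ffun G -> 'I_q}) : proper f -> chi G <= q.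
Proof.
by move=> fP; rewrite /chi; case: ex_minnP => n _; apply; apply/existsP; exists f.
Qed.

Lemma proper_pullback (G H : sgraph) (h : G -> H) q (f : {ffun H -> 'I_q}) :
  (forall x y, adj x y -> adj (h x) (h y)) -> proper f ->
  proper [ffun x => f (h x)].
Proof.
by move=> hP /proper_colouringP fP; apply/proper_colouringP=> x y /hP/fP; rewrite !ffunE.
Qed.

(** First-fit: vertices are coloured by increasing rank, each with the least colour missing from its
    out-neighbours, so every smaller colour does occur there. *)
Lemma greedy_colouring (V : finType) (e : rel V) (rk : V -> nat) :
  (forall x y, e x y -> rk y < rk x) ->
  exists f : V -> nat, forall x, (forall y, e x y -> f y != f x) /\
    (forall c, c < f x -> exists2 y, e x y & f y = c).
Proof.
move=> eP.
suff fP n : exists f : V -> nat, forall x, rk x < n ->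
    (forall y, e x y -> f y != f x) /\
    (forall c, c < f x -> exists2 y, e x y & f y = c).
  have [f fP'] := fP (\max_x rk x).+1; exists f => x; apply: fP'.
  by rewrite ltnS leq_bigmax.
elim: n => [|n [f fP]]; first by exists (fun=> 0).
have mexP x : exists c, ~~ [exists y, e x y && (f y == c)].
  exists (\max_y f y).+1; rewrite negb_exists; apply/forallP=> y.
  by rewrite negb_and neq_ltn ltnS leq_bigmax orbT.
pose g x := if rk x < n then f x else ex_minn (mexP x).
have g_lower x y : rk x < n.+1 -> e x y -> g y = f y.
  by rewrite ltnS /g => ltxn /eP ltyx; rewrite (leq_trans ltyx ltxn).
exists g => x ltxn; split=> [y xy | c].
  rewrite (g_lower x y) // /g; case: ifP => [ltx | _].
    by have [-> ] := fP x ltx.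
  case: ex_minnP => c; rewrite negb_exists => /forallP/(_ y) + _.
  by rewrite xy.
rewrite {1}/g; case: ifP => [ltx | _ ].
  by have [_ fx] := fP x ltx => /fx[y xy <-]; exists y; rewrite // (g_lower x).
case: ex_minnP => m _ minm ltcm.
have /existsP[y /andP[xy /eqP <-]] : [exists y, e x y && (f y == c)].
  by apply: contraLR ltcm; rewrite -leqNgt; apply: minm.
by exists y; rewrite // (g_lower x).
Qed.

(** * Rooted forests as parent maps *)

Section RootedForests.

Variables (V : finType) (p : {ffun V -> V}).
Hypothesis forest_p : rooted_forest p.

Lemma forest_root x : exists n, p (iter n p x) = iter n p x.
Proof.
have /forallP/(_ x)/existsP[r /andP[/iter_findex <- /eqP pr]] := forest_p.
by exists (findex p x r).
Qed.

(** A vertex on a cycle recurs forever in its own orbit, while the orbit ends at a fixed root; hence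
    the vertex is that root. *)
Lemma forest_acyclic x y : fconnect p x y -> fconnect p y x -> x = y.
Proof.
have cycle_root z n : iter n.+1 p z = z -> p z = z.
  move=> cyc; have [m pm] := forest_root z.
  have fixm j : iter (j + m) p z = iter m p z by elim: j => //= j ->.
  have itz j : iter (n.+1 * j) p z = z.
    by elim: j => [|j IHj]; rewrite ?muln0 // mulnSr addnC iterD IHj.
  by have zE : iter m p z = z; [rewrite -[RHS](itz m) mulSn addnC fixm | rewrite -zE].
move=> /iter_findex <-; set n := findex _ _ _ => /iter_findex.
rewrite -iterD; case: n => [|n] //; rewrite addnS => /cycle_root px.
by rewrite iter_fix.
Qed.

Lemma order_parent x : p x != x -> order p x = (order p (p x)).+1.
Proof.
move=> neq; case: (orderPcycle p x) => // cyc _; case/eqP: neq.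
by apply/esym/forest_acyclic; rewrite ?fconnect1 ?fconnect_f.
Qed.

End RootedForests.

Lemma elimination_forestP (G : sgraph) k : treedepth G <= k ->
  exists p : {ffun G -> G}, [/\ rooted_forest p,
    forall x y, adj x y -> fconnect p x y || fconnect p y x &
    forall x, order p x <= k].
Proof.
rewrite /treedepth; case: ex_minnP => d /existsP[p].
move=> /andP[/andP[forest_p closP] /eqP depth_p] _ le_dk.
exists p; split=> // [x y xy | x].
  have /forallP/(_ x)/forallP/(_ y)/implyP/(_ xy) := closP.
  by rewrite /forest_closure /= orbC => /andP[].
by rewrite (leq_trans _ le_dk) // -depth_p; exact: (@leq_bigmax _ (vertex_depth p) x).
Qed.

Lemma treedepth_le (G : sgraph) (p : {ffun G -> G}) k :
  rooted_forest p ->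
  (forall x y, adj x y -> fconnect p x y || fconnect p y x) ->
  (forall x, order p x <= k) -> treedepth G <= k.
Proof.
move=> forest_p closP depth_p; rewrite /treedepth; case: ex_minnP => d _ min_d.
apply: (@leq_trans (forest_depth p)); last by apply/bigmax_leqP=> x _; exact: depth_p.
apply/min_d/existsP; exists p; rewrite eqxx andbT /elimination_forest forest_p.
apply/forallP=> x; apply/forallP=> y; apply/implyP=> xy.
rewrite /forest_closure /= /ancestor orbC closP // andbT.
by apply: contraTneq xy => ->; rewrite adj_irr.
Qed.

(* In a first-fit colouring along an elimination forest, let [u] be a neighbour
   of [x] of the colour preceding that of [x]. Both have neighbours of all
   smaller colours among the ancestors of [x], and these are distinct because
   there is no triangle. *)
Lemma chi_triangle_free_treedepth (G : sgraph) k :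
  triangle_free G -> treedepth G <= k -> chi G <= k./2.+1.
Proof.
move=> tfG /elimination_forestP[p [forest_p closP depth_p]].
pose up x y := adj x y && fconnect p x y.
have up_order x y : up x y -> order p y < order p x.
  move=> /andP[xy x_y]; apply/proper_card/properP; split.
    by apply/subsetP=> z; apply: connect_trans x_y.
  exists x; first exact: connect0.
  apply: contraTN xy => y_x.
  by rewrite (forest_acyclic forest_p x_y y_x) adj_irr.
have [f fP] := greedy_colouring up_order.
have f_le x : f x < k./2.+1.
  rewrite ltnS; case fx: (f x) => [//|c].
  have [_ fx_up] := fP x; rewrite fx in fx_up.
  have [u xu fu] := fx_up c (ltnSn c); have [_ fu_up] := fP u.
  have card_up y m : (forall i, i < m -> exists2 z, up y z & f z = i) ->
      m <= #|up y|.
    move=> mP; rewrite cardE -(size_iota 0 m) -(size_map f).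
    apply: uniq_leq_size (iota_uniq 0 m) _ => i; rewrite mem_iota => /= /mP[z yz <-].
    by apply: map_f; rewrite mem_enum.
  have disj : #|[predI up x & up u]| = 0.
    apply/eqP/pred0P=> z; apply/negP=> /= /andP[/andP[xz _] /andP[uz _]].
    by case: (tfG x u z); split=> //; case/andP: xu.
  have sub : [predU1 x & [predU up x & up u]] \subset fconnect p x.
    apply/subsetP=> z; rewrite !inE => /or3P[/eqP -> | /andP[] // | /andP[_ u_z]].
      exact: connect0.
    by case/andP: xu => _ /connect_trans; apply.
  have xN : x \notin [predU up x & up u].
    have /negbTE upux : ~~ up u x.
      by apply/negP=> /up_order; rewrite ltnNge ltnW // up_order.
    by rewrite !inE -!topredE /= upux /up adj_irr.
  (* On the path from [x] to its root lie [x], at least [c.+1] upper neighbours of [x] and at least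
     [c] of [u], all distinct, whence [2 * c.+1 <= k]. *)
  have := leq_trans (subset_leq_card sub) (depth_p x); rewrite cardU1 xN.
  have := cardUI (up x) (up u).
  rewrite disj addn0 => -> le_k; rewrite geq_half_double.
  apply: leq_trans le_k; rewrite doubleS -addnn.
  by rewrite -[X in X <= _]/(1 + (c.+1 + c)) leq_add2l leq_add ?card_up //
    => i lt_ic; apply: fu_up; rewrite fu.
have f_proper : proper [ffun x => Ordinal (f_le x)].
  apply/proper_colouringP=> x y xy; rewrite !ffunE.
  have /orP[x_y | y_x] := closP x y xy.
    by rewrite eq_sym; have [fx _] := fP x; apply: fx; rewrite /up xy.
  by have [fy _] := fP y; apply: fy; rewrite /up adj_sym xy.
exact: chi_le f_proper.
Qed.

(** * The universal graph *)

Section WordGraph.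

Variables (k : nat) (T : finType).

(* A letter at position [b] of a word tells which earlier positions are linked
   to [b]; the tag in [T] only serves to produce copies of a vertex. *)
Definition letter : Type := (k.-tuple bool * T)%type.

Implicit Types s x y z : seq letter.

Definition bit s b a :=
  (a < b) && nth false (nth [::] [seq tval l.1 | l <- s] b) a.

(* The links of a position whose linked positions are not pairwise unlinked are
   discarded, which makes the word graph triangle-free. *)
Definition link s b a := bit s b a &&
  all (fun c => all (fun d => ~~ [&& bit s b c, bit s b d & bit s d c])
    (iota 0 b)) (iota 0 b).

(** A nonempty word stands for its last position, and its nonempty prefixes for the earlier ones.
    The empty word is excluded because [(size x).-1] would confuse it with position [0]. *)
Definition word_down x y :=
  [&& 0 < size x, prefix x y & link y (size y).-1 (size x).-1].

Lemma bit_prefix s s' b a : prefix s s' -> b < size s -> bit s b a = bit s' b a.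
Proof.
by move=> /prefixP[s2 ->] ltb; rewrite /bit map_cat nth_cat size_map ltb.
Qed.

Lemma bit_lt s b a : bit s b a -> a < b.
Proof. by case/andP. Qed.

Lemma word_down_size x y : word_down x y -> size x < size y.
Proof.
case/and3P; case: x => // a x _ _ /andP[/bit_lt + _] /=.
by case: y.
Qed.

Definition word_adj : rel (k.-bseq letter) :=
  fun x y : k.-bseq letter => word_down x y || word_down y x.

Lemma word_adj_sym : symmetric word_adj.
Proof. by move=> x y; rewrite /word_adj orbC. Qed.

Lemma word_adj_irr : irreflexive word_adj.
Proof.
by move=> x; rewrite /word_adj orbb; apply/negP=> /word_down_size; rewrite ltnn.
Qed.

Definition word_graph := SGraph word_adj_sym word_adj_irr.

(** The bit joining [y] to [x] survives in [z], of which [y] is a prefix; the last position of [z]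
    would then be linked to two positions joined by a bit, which [link] forbids. *)
Lemma word_down_triangle x y z :
  word_down x y -> word_down y z -> word_down x z -> False.
Proof.
move=> xy yz xz; have ltxy := word_down_size xy.
case/and3P: xz => x_gt0 _ /andP[bxz _].
case/and3P: yz => y_gt0 pre_yz /andP[byz /allP indep].
have := indep (size x).-1; rewrite mem_iota (bit_lt bxz) => /(_ isT)/allP.
move/(_ (size y).-1); rewrite mem_iota (bit_lt byz) bxz byz => /(_ isT).
case/and3P: xy => _ _ /andP[+ _].
by rewrite (bit_prefix _ pre_yz) ?prednK // => ->.
Qed.

Lemma word_graph_triangle_free : triangle_free word_graph.
Proof.
have sizes (x y : word_graph) : word_down x y -> size x < size y.
  exact: word_down_size.
move=> x y z [/orP[xy|yx] /orP[yz|zy] /orP[xz|zx]].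
- exact: word_down_triangle xy yz xz.
- by have := ltn_trans (sizes _ _ xy) (ltn_trans (sizes _ _ yz) (sizes _ _ zx));
    rewrite ltnn.
- exact: word_down_triangle xz zy xy.
- exact: word_down_triangle zx xy zy.
- exact: word_down_triangle yx xz yz.
- exact: word_down_triangle yz zx yx.
- by have := ltn_trans (sizes _ _ yx) (ltn_trans (sizes _ _ xz) (sizes _ _ zy));
    rewrite ltnn.
- exact: word_down_triangle zy yx zx.
Qed.

(** One-letter words are roots, so the depth of a nonempty word is its length; a common empty root
    would cost one more level. *)
Definition word_parent : {ffun word_graph -> word_graph} :=
  [ffun x : k.-bseq letter => if size x <= 1 then x else take_bseq (size x).-1 x].

Lemma iter_word_parent n (x : word_graph) :
  iter n word_parent x = take (maxn 1 (size x - n)) x :> seq letter.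
Proof.
elim: n => [|n IHn]; first by rewrite subn0 take_oversize // leq_maxr.
rewrite iterS ffunE subnS; case def_m: (size x - n) IHn => [|[|m]] IHn.
- by rewrite {1}IHn size_take_min geq_min.
- by rewrite {1}IHn size_take_min geq_min.
have le_m : m.+2 <= size x by rewrite -def_m leq_subr.
have sz : size (iter n word_parent x) = m.+2 by rewrite IHn size_takel.
rewrite sz -[LHS]/(take m.+1 (iter n word_parent x)) IHn.
by rewrite take_takel ?(maxn_idPr _).
Qed.

Lemma word_graph_treedepth : 0 < k -> treedepth word_graph <= k.
Proof.
move=> k_gt0; apply: (treedepth_le (p := word_parent)) => [|x y xy|x].
- apply/forallP=> x; apply/existsP; exists (iter k word_parent x).
  rewrite fconnect_iter /=; apply/eqP/val_inj.
  rewrite [LHS](iter_word_parent k.+1) [RHS]iter_word_parent.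
  have /eqP -> : size x - k == 0 by rewrite subn_eq0 size_bseq.
  by have /eqP -> : size x - k.+1 == 0 by rewrite subn_eq0 leqW ?size_bseq.
- have downP (u v : word_graph) : word_down u v -> fconnect word_parent v u.
    move=> uv; have lt_uv := word_down_size uv.
    case/and3P: uv => u_gt0 /[!prefixE]/eqP uE _.
    suff -> : u = iter (size v - size u) word_parent v by exact: fconnect_iter.
    apply: val_inj; rewrite [RHS]iter_word_parent subKn 1?ltnW //.
    by rewrite (maxn_idPr u_gt0) uE.
  by case/orP: xy => /downP -> //; rewrite orbT.
(* The empty word is a root of depth [1]; this is where [0 < k] enters. *)
have [/size0nil x0 | x_gt0] := posnP (size x).
  have fx : fcycle word_parent [:: x].
    by rewrite /= /frel /= ffunE x0 eqxx.
  by rewrite (leq_trans (order_le_cycle fx (mem_head _ _))).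
apply: leq_trans (size_bseq x).
have loop : looping word_parent x (size x).
  rewrite /looping -(prednK x_gt0); apply/trajectP; exists (size x).-1 => //.
  apply/val_inj; rewrite [LHS]iter_word_parent [RHS]iter_word_parent.
  rewrite prednK // subnn maxn0.
  by rewrite -subn1 subKn.
rewrite -(size_traject word_parent x (size x)) /order.
apply: leq_trans (card_size _); apply: subset_leq_card.
by apply/subsetP=> y /iter_findex <-; apply: (loopingP loop).
Qed.

End WordGraph.

(** Links read the bit vectors alone, so words can be compared across different tags and even
    different tag types. *)
Lemma eq_link k (T T' : finType) (s : seq (letter k T)) (s' : seq (letter k T')) :
  [seq l.1 | l <- s] = [seq l.1 | l <- s'] -> link s =2 link s'.
Proof.
have mapE (U : finType) (z : seq (letter k U)) :
  [seq tval l.1 | l <- z] = [seq tval u | u <- [seq l.1 | l <- z]]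
    by rewrite -map_comp.
by move=> eq_s b a; rewrite /link /bit !mapE eq_s.
Qed.

Definition bits k (P : pred nat) : k.-tuple bool := [tuple P i | i < k].

Lemma nth_bits k (P : pred nat) a : nth false (bits k P) a = (a < k) && P a.
Proof.
case: (ltnP a k) => [lt_ak | le_ka]; last by rewrite nth_default ?size_tuple.
by rewrite -[a]/(val (Ordinal lt_ak)) -tnth_nth tnth_mktuple.
Qed.

Section Branches.

Variables (V : finType) (p : {ffun V -> V}).
Hypothesis forest_p : rooted_forest p.

(** Listed from the root down, so that a vertex has the same index in every branch through it. *)
Definition branch (v : V) := rev (orbit p v).

Lemma size_branch v : size (branch v) = order p v.
Proof. by rewrite size_rev size_orbit. Qed.

Lemma mem_branch v u : (u \in branch v) = fconnect p v u.
Proof. by rewrite mem_rev fconnect_orbit. Qed.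

Lemma branch_rcons v :
  branch v = rcons (if p v == v then [::] else branch (p v)) v.
Proof.
have split_orbit : orbit p v = v :: (if p v == v then [::] else orbit p (p v)).
  rewrite /orbit -orderSpred; case: eqP => [pv | /eqP neq].
    suff -> : order p v = 1 by [].
    have fv : fcycle p [:: v] by rewrite /= /frel /= pv eqxx.
    by apply: (order_cycle fv); rewrite ?mem_head.
  by rewrite (order_parent forest_p neq).
by rewrite /branch split_orbit rev_cons; case: ifP.
Qed.

Lemma branch_nth v d : d < size (branch v) ->
  branch (nth v (branch v) d) = take d.+1 (branch v).
Proof.
have [n] := ubnP (size (branch v)); elim: n v => // n IHn v.
rewrite branch_rcons size_rcons ltnS => le_n; rewrite ltnS leq_eqVlt.
rewrite nth_rcons; case: eqP => /= [-> _ | _ ltd].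
  by rewrite ltnn take_oversize ?size_rcons // -branch_rcons.
rewrite ltd -cats1 take_cat.
case: (p v == v) le_n ltd => //= le_n ltd.
rewrite (set_nth_default (p v)) // IHn //.
move: ltd; rewrite leq_eqVlt => /predU1P[-> | ->] //.
by rewrite ltnn subnn cats0 take_size.
Qed.

End Branches.

(* A vertex goes to the list of the adjacency patterns met along its branch. *)
Lemma word_graph_universal (G : sgraph) k (T : finType) (t : T) :
  triangle_free G -> treedepth G <= k ->
  exists h : G -> word_graph k T, forall x y, adj x y -> adj (h x) (h y).
Proof.
move=> tfG /elimination_forestP[p [forest_p closP depth_p]].
pose S (u : G) := (bits k (fun a => adj u (nth u (branch p u) a)), t).
have size_code v : size [seq S u | u <- branch p v] <= k.
  by rewrite size_map size_branch.
pose h v : word_graph k T := Bseq (size_code v).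
have bit_code v b a : b < size (branch p v) ->
    bit [seq S u | u <- branch p v] b a ->
    adj (nth v (branch p v) b) (nth v (branch p v) a) /\ a < b.
  move=> ltb; rewrite /bit -map_comp (nth_map v) // nth_bits => /and3P[lt_ab _].
  rewrite (branch_nth forest_p) //; set u := nth v _ b => u_adj.
  split=> //; move: u_adj; rewrite nth_take 1?ltnW //.
  by rewrite (set_nth_default v) // (ltn_trans lt_ab).
have hP x y : adj x y -> fconnect p y x -> word_down (h x) (h y).
  move=> xy; rewrite -mem_branch => /(nthP y)[d ltd xE].
  have branch_x : branch p x = take d.+1 (branch p y).
    by rewrite -xE (branch_nth forest_p).
  have size_x : size (branch p x) = d.+1 by rewrite branch_x size_takel.
  have y_last : nth y (branch p y) (size (branch p y)).-1 = y.
    by rewrite nth_last branch_rcons // last_rcons.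
  have lt_db : d < (size (branch p y)).-1.
    rewrite -ltnS (ltn_predK ltd) ltn_neqAle ltd andbT.
    have neq_xy : x != y by apply: contraTneq xy => ->; rewrite adj_irr.
    apply: contraNneq neq_xy => eq_d.
    by rewrite -xE -[X in _ == X]y_last -eq_d.
  have lt_by : (size (branch p y)).-1 < size (branch p y).
    by rewrite ltn_predL (leq_trans _ ltd).
  apply/and3P; split; rewrite /= ?size_map ?size_x //.
    by rewrite branch_x map_take prefix_take.
  apply/andP; split.
    rewrite /bit -map_comp (nth_map y) // nth_bits y_last xE adj_sym xy andbT.
    by rewrite lt_db (leq_trans ltd) // size_branch.
  (* Positions violating independence would come from a triangle of [G], so no link of a code is
     discarded. *)
  apply/allP=> c _; apply/allP=> e _; apply/and3P=> [[]].
  move=> /(bit_code _ _ _ lt_by)[yc _] /(bit_code _ _ _ lt_by)[ye lt_e].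
  move=> /(bit_code _ _ _ (ltn_trans lt_e lt_by))[ec _].
  exact: (tfG _ _ _ (And3 ye ec yc)).
exists h => x y xy; have /orP[x_y | y_x] := closP _ _ xy.
  by apply/orP; right; apply: hP; rewrite // adj_sym.
by apply/orP; left; apply: hP.
Qed.

(** * Defective colourings of the universal graph *)

Section Positions.

Variables (k : nat) (T : finType) (q : nat).
Variable f : {ffun word_graph k T -> 'I_q}.
Implicit Types s z : seq (letter k T).

Definition word_colour s : 'I_q := f (insub_bseq k s).

Lemma insub_bseqK s : size s <= k -> insub_bseq k s = s :> seq _.
Proof. by move=> le_sk; rewrite [LHS]val_insubd le_sk. Qed.

Lemma link_adj s l a : size s < k -> link (rcons s l) (size s) a ->
  @adj (word_graph k T) (insub_bseq k (take a.+1 s)) (insub_bseq k (rcons s l)).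
Proof.
move=> lt_sk ab; have lt_as : a < size s by case/andP: ab => /bit_lt.
apply/orP; left; rewrite /word_down !insub_bseqK ?size_rcons //; last first.
  by rewrite size_takel // (leq_trans lt_as) // ltnW.
rewrite size_takel //= ab andbT.
exact: prefix_trans (prefix_take _ _) (prefix_rcons _ _).
Qed.

End Positions.

(* A word is lifted letter by letter; if every tag of the next letter led to a
   monochromatic edge, more than [d] of these edges would share their upper end. *)
Lemma defective_lift k q d (T : finType)
    (f : {ffun word_graph k 'I_(k * d).+1 -> 'I_q}) :
  has_defect f d -> exists g : {ffun word_graph k T -> 'I_q}, proper g.
Proof.
move=> fP; set col := word_colour f.
pose bad z t j a := link (rcons z (t, j)) (size z) a &&
  (col (take a.+1 z) == col (rcons z (t, j))).
have goodP z t : size z < k -> exists j, all (fun a => ~~ bad z t j a) (iota 0 (size z)).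
  move=> lt_zk; apply/existsP; apply: contraTT (ltnSn (k * d)).
  rewrite negb_exists => /forallP all_bad; rewrite -leqNgt.
  (* For a fixed [a], distinct bad tags give distinct neighbours of the vertex [take a.+1 z], all of
     its colour. *)
  have bad_le a : a < size z -> \sum_j (bad z t j a : nat) <= d.
    move=> lt_az; pose h j : word_graph _ _ := insub_bseq k (rcons z (t, j)).
    have h_inj : injective h.
      move=> i j /(congr1 (@bseqval _ _)); rewrite !insub_bseqK ?size_rcons //.
      by move/rcons_inj => [].
    have -> : \sum_j (bad z t j a : nat) = #|[set j | bad z t j a]|.
      rewrite -sum1_card [RHS]big_mkcond /=; apply: eq_bigr => j _.
      by rewrite inE; case: (bad z t j a).
    rewrite -(card_imset _ h_inj).
    apply: leq_trans (defect_neighbours fP (insub_bseq k (take a.+1 z))).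
    apply/subset_leq_card/subsetP=> _ /imsetP[j + ->]; rewrite !inE.
    by case/andP=> /link_adj-> //; rewrite eq_sym.
  rewrite -[X in X <= _]card_ord -sum1_card.
  (* Double counting of pairs of a tag and a bad position: each of the [(k * d).+1] tags
     contributes, yet there are at most [k * d] pairs. *)
  apply: (@leq_trans (\sum_j \sum_(a < size z) bad z t j a)).
    apply: leq_sum => j _; have /allPn[a] := all_bad j.
    rewrite mem_iota negbK /= => lt_az bad_a.
    by rewrite (bigD1 (Ordinal lt_az)) //= bad_a.
  rewrite exchange_big /=; apply: (@leq_trans (size z * d)); last first.
    by rewrite leq_mul2r ltnW ?orbT.
  rewrite -[X in _ <= X * d]card_ord -sum_nat_const.
  by apply: leq_sum => a _; apply: bad_le.
(* By [goodP], the default [ord0] can only be reached for words of length at least [k]. *)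
pose tag z t := odflt ord0 [pick j | all (fun a => ~~ bad z t j a) (iota 0 (size z))].
pose lift := foldl (fun z (l : letter k T) => rcons z (l.1, tag z l.1)) [::].
have lift_rcons s l : lift (rcons s l) = rcons (lift s) (l.1, tag (lift s) l.1).
  exact: foldl_rcons.
have lift_letters s : [seq l.1 | l <- lift s] = [seq l.1 | l <- s].
  by elim/last_ind: s => // s l IHs; rewrite lift_rcons !map_rcons IHs.
have size_lift s : size (lift s) = size s.
  by have := congr1 size (lift_letters s); rewrite !size_map.
(* Tags are chosen from left to right, so lifting commutes with prefixes; as links ignore tags, it
   preserves edges. *)
have lift_take n s : lift (take n s) = take n (lift s).
  elim/last_ind: s => [|s l IHs]; first by case: n.
  have [le_n | lt_n] := leqP n (size s); last first.
    by rewrite !take_oversize ?size_lift // size_rcons.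
  by rewrite lift_rcons -!cats1 !takel_cat ?size_lift.
exists [ffun x : word_graph k T => col (lift x)]; apply/proper_colouringP.
suff downP (x y : word_graph k T) : word_down x y -> col (lift x) != col (lift y).
  by move=> x y; rewrite !ffunE => /orP[] /downP //; rewrite eq_sym.
case/and3P => x_gt0; rewrite prefixE => /eqP xE; have := size_bseq y.
have -> : lift x = take (size x) (lift y) by rewrite -lift_take xE.
case/lastP: (y : seq _) => [|s l]; first by move=> _ /andP[/bit_lt].
rewrite size_rcons /= => lt_sk sx.
have lt_xs : (size x).-1 < size s by case/andP: sx => /bit_lt.
have : link (lift (rcons s l)) (size s) (size x).-1.
  by rewrite (eq_link (lift_letters _)).
rewrite lift_rcons.
have -> : take (size x) (rcons (lift s) (l.1, tag (lift s) l.1)) = take (size x) (lift s).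
  by rewrite -cats1 takel_cat // size_lift -(prednK x_gt0).
move: lt_sk lt_xs.
rewrite -(size_lift s); set z := lift s => lt_zk lt_xz zx.
have : all (fun a => ~~ bad z l.1 (tag z l.1) a) (iota 0 (size z)).
  rewrite /tag; case: pickP => [j // | none].
  by have [j jP] := goodP z l.1 lt_zk; rewrite none in jP.
move/allP/(_ (size x).-1); rewrite mem_iota lt_xz => /(_ isT).
by rewrite /bad zx prednK.
Qed.

(** * The on-line adversary *)

Section Adversary.

Variables (k : nat) (T : finType) (t : T) (q : nat).
Variable f : {ffun word_graph k T -> 'I_q}.
Hypothesis f_proper : proper f.
Implicit Types (s : seq (letter k T)) (I J K L : seq nat).

Definition position_colour s a := word_colour f (take a.+1 s).

Local Notation colour := position_colour.

(** Independence is asked of the raw bits because these are what [link] tests when a later position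
    is linked to part of [K]. *)
Definition rainbow s K := [&& all (gtn (size s)) K, uniq (map (colour s) K) &
  all (fun c => all (fun a => ~~ bit s c a) K) K].

Lemma position_colour_rcons s l a :
  a < size s -> colour (rcons s l) a = colour s a.
Proof. by move=> lt_as; rewrite /colour -cats1 takel_cat. Qed.

Lemma map_position_colour_rcons s l K :
  all (gtn (size s)) K -> map (colour (rcons s l)) K = map (colour s) K.
Proof. by move/allP=> ltK; apply/eq_in_map=> a /ltK/position_colour_rcons. Qed.

Lemma rainbow_subseq s K L : subseq L K -> rainbow s K -> rainbow s L.
Proof.
move=> subLK /and3P[ltK uniqK /allP indK]; have memLK := mem_subseq subLK.
rewrite /rainbow (subseq_uniq (map_subseq _ subLK) uniqK).
apply/and3P; split=> //; first by apply/allP=> a /memLK; exact: (allP ltK).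
apply/allP=> c /memLK/indK/allP indc; apply/allP=> a /memLK; exact: indc.
Qed.

Lemma rainbow_rcons s l K : rainbow s K -> rainbow (rcons s l) K.
Proof.
case/and3P=> /[dup] ltK /allP memK uniqK /allP indK.
rewrite /rainbow map_position_colour_rcons // uniqK size_rcons.
apply/and3P; split=> //; first by apply/allP=> a /memK /= /ltnW.
apply/allP=> c cK; apply/allP=> a aK.
rewrite -(bit_prefix _ (prefix_rcons s l)); first exact: (allP (indK c cK)).
exact: memK.
Qed.

Lemma rainbow_cons s l K : rainbow s K ->
  colour (rcons s l) (size s) \notin map (colour s) K ->
  (forall a, a \in K -> ~~ bit (rcons s l) (size s) a) ->
  rainbow (rcons s l) (size s :: K).
Proof.
move=> rainK new unlinked; have /and3P[ltK _ _] := rainK.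
have /and3P[lt1K uniq1K ind1K] := rainbow_rcons l rainK.
rewrite /rainbow /= size_rcons ltnSn uniq1K map_position_colour_rcons // new.
rewrite size_rcons in lt1K; rewrite lt1K /=; apply/andP; split.
  apply/andP; split; first by apply/negP=> /bit_lt; rewrite ltnn.
  exact/allP.
apply/allP=> c cK; rewrite (allP ind1K) // andbT.
apply/negP=> /bit_lt; rewrite ltnNge ltnW //; exact: (allP ltK).
Qed.

Lemma bit_rcons_bits s (P : pred nat) a :
  bit (rcons s (bits k P, t)) (size s) a = [&& a < size s, a < k & P a].
Proof.
rewrite /bit map_rcons nth_rcons size_map ltnn eqxx.
by rewrite -[X in nth false X a]/(tval (bits k P)) nth_bits.
Qed.

(** All positions in [P] belong to the independent set [I], so the new letter passes the test in
    [link] and keeps its links. *)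
Lemma link_rcons_bits s I (P : pred nat) : size s < k -> rainbow s I ->
    (forall a, P a -> a \in I) ->
  forall a, P a -> link (rcons s (bits k P, t)) (size s) a.
Proof.
move=> lt_sk /and3P[/allP ltI _ /allP indI] PI a Pa.
have lt_as : a < size s := ltI a (PI a Pa).
rewrite /link bit_rcons_bits lt_as Pa (ltn_trans lt_as lt_sk) /=.
apply/allP=> c _; apply/allP=> d _; rewrite !bit_rcons_bits.
apply/negP=> /and3P[/and3P[_ _ /PI cI] /and3P[lt_ds _ /PI dI]].
rewrite -(bit_prefix _ (prefix_rcons _ _)) //; apply/negP.
exact: (allP (indI d dI)).
Qed.

(* Against a proper colouring, the rainbow set [J ++ I'], where [I'] is obtained
   from [I] by removing the colours of [J], is enlarged by appending a position
   linked to the positions of [I] whose colour is used on [J]: its colour is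
   either new or that of a position of [I] which it then replaces. *)
Lemma rainbow_exchange r s I J :
    let K := J ++ [seq a <- I | colour s a \notin map (colour s) J] in
    rainbow s I -> rainbow s K -> {in J, forall a, a \notin I} ->
    {subset map (colour s) J <= map (colour s) I} ->
    size J + r = (size I).+1 -> size s + r <= k ->
  exists s' K', [/\ size s' <= size s + r, rainbow s' K' &
    size K' = (size I).+1].
Proof.
elim: r s J => [|r IHr] s J K rainI rainK disjJI subJI sizeJ le_k.
  (* With [r = 0], [J] would carry more distinct colours than [I] has positions. *)
  have := uniq_leq_size _ subJI; rewrite !size_map -[size J]addn0 sizeJ ltnn.
  case/and3P: rainK => _ + _; rewrite map_cat cat_uniq => /andP[uJ _] /(_ uJ).
  by [].
pose P := [pred a | (a \in I) && (colour s a \in map (colour s) J)].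
pose s1 := rcons s (bits k P, t); set b := size s; pose c := colour s1 b.
have lt_sk : b < k by apply: leq_trans le_k; rewrite addnS ltnS leq_addr.
have [[ltI _ _] [ltK uniqK _]] := (and3P rainI, and3P rainK).
have colour1 L : all (gtn b) L -> map (colour s1) L = map (colour s) L.
  exact: map_position_colour_rcons.
have cP a : P a -> c != colour s a.
  move=> Pa; have /andP[aI _] := Pa.
  have lab : link s1 b a.
    by apply: (link_rcons_bits lt_sk rainI _ Pa) => d /andP[].
  rewrite eq_sym; have /proper_colouringP := f_proper.
  move/(_ _ _ (link_adj lt_sk lab)).
  by rewrite /c /colour [take b.+1 _]take_oversize ?size_rcons.
(* Every colour of [J] also occurs on a position of [I] linked to the new one, so [c] must avoid
   it. *)
have cNJ : c \notin map (colour s) J.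
  apply/negP=> cJ; have /mapP[a aI ca] := subJI _ cJ.
  have Pa : P a by rewrite /P /= aI -ca.
  by have := cP a Pa; rewrite ca eqxx.
have unlinked a : a \in K -> ~~ bit s1 b a.
  rewrite bit_rcons_bits mem_cat mem_filter => aK.
  apply/negP=> /and3P[_ _ /andP[aI aJ]]; case/orP: aK => [/disjJI | ].
    by rewrite aI.
  by rewrite aJ.
have [cI | cNI] := boolP (c \in map (colour s) I); last first.
  exists s1, (b :: K); split.
  - by rewrite size_rcons addnS ltnS leq_addr.
  - apply: rainbow_cons => //; apply: contra cNI => /mapP[a aK ca]; rewrite /c ca.
    move: aK; rewrite mem_cat mem_filter => /orP[aJ | /andP[_ aI]].
      by apply: subJI; apply: map_f.
    exact: map_f.
  (* [K] shows exactly the colours of [I], once each, so adding the new position gives one more. *)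
  - rewrite /= -(size_map (colour s) K) -(size_map (colour s) I); congr _.+1.
    apply/perm_size/uniq_perm => // [|d]; first by case/and3P: rainI.
    apply/mapP/mapP=> [[a] | [a aI ->]].
      rewrite mem_cat mem_filter => /orP[aJ | /andP[_ aI]] ->; last by exists a.
      by have /mapP := subJI _ (map_f (colour s) aJ).
    have [/mapP[e eJ ->]|aNJ] := boolP (colour s a \in map (colour s) J).
      by exists e; rewrite // mem_cat eJ.
    by exists a; rewrite // mem_cat mem_filter aNJ aI orbT.
have allJ : all (gtn b) J by move: ltK; rewrite all_cat => /andP[].
have col_bJ : map (colour s1) (b :: J) = c :: map (colour s) J.
  by rewrite /= colour1.
(* Here [c] repeats a colour of [I]: the new position joins [J], and the position of [I] with colour
   [c] leaves the rainbow set. *)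
have [||||||s' [K' [le_s' rainK' sizeK']]] := IHr s1 (b :: J).
- exact: rainbow_rcons.
- have -> : [seq a <- I | colour s1 a \notin map (colour s1) (b :: J)] =
    [seq a <- I | colour s a \notin c :: map (colour s) J].
    by apply: eq_in_filter => a /(allP ltI) lta; rewrite position_colour_rcons // col_bJ.
  rewrite cat_cons; set L := J ++ _.
  have subLK : subseq L K.
    rewrite cat_subseq //.
    have -> : [seq a <- I | colour s a \notin c :: map (colour s) J] =
      [seq a <- [seq a <- I | colour s a \notin map (colour s) J] | colour s a != c].
      by rewrite -filter_predI; apply: eq_filter => a; rewrite /= inE negb_or.
    exact: filter_subseq.
  apply: rainbow_cons (rainbow_subseq subLK rainK) _ _.
    apply/mapP=> -[a + ca]; rewrite mem_cat mem_filter => /orP[aJ | ].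
      by case/negP: cNJ; rewrite /c ca map_f.
    by rewrite -ca mem_head.
  by move=> a /(mem_subseq subLK)/unlinked.
- move=> a; rewrite inE => /predU1P[-> | /disjJI //].
  by apply/negP=> /(allP ltI); rewrite /= ltnn.
- rewrite col_bJ (colour1 I ltI) => d; rewrite inE => /predU1P[-> //|]; exact: subJI.
- by rewrite /= addSnnS.
- by rewrite size_rcons addSnnS.
by exists s', K'; split=> //; rewrite size_rcons addSnnS in le_s'.
Qed.

Lemma rainbow_increase s I : rainbow s I -> size s + (size I).+1 <= k ->
  exists s' K', [/\ size s' <= size s + (size I).+1, rainbow s' K' &
    size K' = (size I).+1].
Proof.
move=> rainI; apply: (rainbow_exchange (J := [::])) => //=.
by rewrite (eq_filter (a2 := predT)) ?filter_predT.
Qed.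

(** Passing from [i] to [i + 1] colours costs at most [i + 1] positions, and these costs add up to
    the binomial coefficient. *)
Lemma rainbow_exists m : 'C(m.+1, 2) <= k ->
  exists s K, [/\ size s <= 'C(m.+1, 2), rainbow s K & size K = m].
Proof.
elim: m => [|m IHm] le_k; first by exists [::], [::].
have le_km : 'C(m.+1, 2) <= k by apply: leq_trans le_k; rewrite [leqRHS]binS leq_addr.
have [s [K [le_s rainK sizeK]]] := IHm le_km.
move: le_k; rewrite binS bin1 => le_k.
have [|s' [K' [le_s' rainK' sizeK']]] := rainbow_increase rainK.
  by rewrite sizeK (leq_trans _ le_k) ?leq_add.
by exists s', K'; rewrite sizeK' sizeK; split=> //; apply: leq_trans le_s' _;
  rewrite sizeK leq_add.
Qed.

Lemma adversary_colours m : 'C(m.+1, 2) <= k -> m <= q.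
Proof.
move=> /rainbow_exists[s [K [_ /and3P[_ /card_uniqP cardK _] <-]]].
by rewrite -(size_map (colour s)) -cardK -[q in leqRHS]card_ord max_card.
Qed.

End Adversary.

(** * The common value and its bounds *)

Definition class_number k := chi (word_graph k unit).

Lemma word_graph_class k (T : finType) :
  0 < k -> triangle_free_treedepth k (word_graph k T).
Proof.
by move=> k_gt0; split; [exact: word_graph_triangle_free|exact: word_graph_treedepth].
Qed.

Lemma class_colouring k (G : sgraph) : triangle_free_treedepth k G ->
  exists f : {ffun G -> 'I_(class_number k)}, proper f.
Proof.
move=> [tfG tdG]; have [f fP] := chi_colouring (word_graph k unit).
have [h hP] := word_graph_universal tt tfG tdG.
by exists [ffun x => f (h x)]; exact: proper_pullback hP fP.
Qed.

Lemma class_number_chromatic k :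
  0 < k -> is_chromatic_number (triangle_free_treedepth k) (class_number k).
Proof.
move=> k_gt0; split=> [|_ [G [/class_colouring[f fP] <-]]]; last exact: chi_le fP.
by exists (word_graph k unit); split=> //; exact: word_graph_class.
Qed.

(** The number of tags is chosen after [d]: a colouring of defect [d] of the graph with [(k * d).+1]
    tags lifts to a proper one of the graph with a single tag. *)
Lemma class_number_le_defective k q d : 0 < k ->
  (forall G : sgraph, triangle_free_treedepth k G ->
    exists f : {ffun G -> 'I_q}, has_defect f d) -> class_number k <= q.
Proof.
move=> k_gt0 /(_ _ (word_graph_class 'I_(k * d).+1 k_gt0))[f fP].
by have [g gP] := defective_lift unit fP; exact: chi_le gP.
Qed.

Lemma class_number_defective k : 0 < k ->
  is_defective_chromatic_number (triangle_free_treedepth k) (class_number k).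
Proof.
move=> k_gt0; split=> [|q [d qP]]; last exact: class_number_le_defective qP.
exists 1 => G /class_colouring[f fP]; exists f.
exact/clustering_defect/proper_clustering.
Qed.

Lemma class_number_clustered k : 0 < k ->
  is_clustered_chromatic_number (triangle_free_treedepth k) (class_number k).
Proof.
move=> k_gt0; split=> [|q [c qP]].
  by exists 1 => G /class_colouring[f fP]; exists f; exact: proper_clustering.
apply: (class_number_le_defective (d := c) k_gt0) => G /qP[f fP].
by exists f; exact: clustering_defect.
Qed.

Lemma class_number_upper k : 0 < k -> class_number k <= k./2.+1.
Proof.
by move=> /(word_graph_class unit)[]; exact: chi_triangle_free_treedepth.
Qed.

(** For the largest [m] with ['C(m.+1, 2) <= k], the adversary gives [m <= class_number k], while
    maximality gives [2 * k < m.+2 * m.+1]. *)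
Lemma class_number_lower k : 2 * k <= (class_number k).+2 ^ 2.
Proof.
pose P m := 'C(m.+1, 2) <= k.
have bin2E m : 'C(m.+1, 2) * 2 = m.+1 * m by rewrite bin_ffact ffactnS ffactn1.
have P_le m : P m -> m <= k.*2.
  move=> Pm; rewrite -muln2; apply: leq_trans (leq_mul Pm (leqnn 2)).
  by rewrite bin2E leq_pmull.
have [m Pm max_m] := ex_maxnP (ex_intro P 0 isT) P_le.
have [f fP] := chi_colouring (word_graph k unit).
have le_mN : m <= class_number k := adversary_colours tt fP Pm.
have lt_k : k < 'C(m.+2, 2).
  by rewrite ltnNge; apply/negP=> /max_m; rewrite ltnn.
rewrite mulnC; apply: (@leq_trans ('C(m.+2, 2) * 2)); first by rewrite leq_mul2r ltnW.
by rewrite bin2E -mulnn leq_mul // ltnW.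
Qed.

Local Open Scope classical_set_scope.
Local Open Scope ring_scope.

Theorem corollary11 (R : realType) :
  exists N : nat -> nat,
    (forall k : nat, (1 <= k)%N ->
      [/\ is_chromatic_number (triangle_free_treedepth k) (N k),
          is_defective_chromatic_number (triangle_free_treedepth k) (N k),
          is_clustered_chromatic_number (triangle_free_treedepth k) (N k)
        & (N k)%:Z <= Num.ceil ((k%:R + 2%:R) / 2%:R : R)]) /\
    (exists eps : nat -> R,
      eps n @[n --> \oo] --> (0 : R) /\
      forall k : nat, (1 <= k)%N ->
        (1 - eps k) * Num.sqrt (2%:R * k%:R) <= (N k)%:R).
Proof.
exists class_number; split=> [k k_gt0|].
  split; [exact: class_number_chromatic | exact: class_number_defective |
          exact: class_number_clustered |].
  (* The bound [k./2.+1 <= (k + 2) / 2] already holds before rounding up. *)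
  rewrite -(ler_int R); apply: le_trans (ceil_ge _).
  rewrite ler_pdivlMr // -natrD -natrM ler_nat.
  have := class_number_upper k_gt0; rewrite -leq_double -muln2 => /leq_trans.
  by apply; rewrite doubleS addn2 !ltnS -[leqRHS]odd_double_half leq_addl.
(* With this choice the left-hand side is [sqrt (2 k) - 2], which is what [class_number_lower]
   bounds. *)
exists (fun k => 2%:R / Num.sqrt (2%:R * k%:R)); split.
  apply/cvgrPdist_lt => e e_gt0; near=> n.
  have n_big : (2%:R / e) ^+ 2 < 2%:R * n%:R.
    rewrite -ltr_pdivrMl //; near: n; exact: nbhs_infty_gtr.
  have n_gt0 : 0 < 2%:R * n%:R :> R by apply: le_lt_trans n_big; exact: sqr_ge0.
  rewrite sub0r normrN ger0_norm ?divr_ge0 ?sqrtr_ge0 //.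
  rewrite ltr_pdivrMr ?sqrtr_gt0 // -ltr_pdivrMl // mulrC.
  have e2_ge0 : 0 <= 2%:R / e by rewrite divr_ge0 // ltW.
  by rewrite -[ltLHS]ger0_norm // -sqrtr_sqr ltr_sqrt.
move=> k k_gt0; have k2_gt0 : 0 < 2%:R * k%:R :> R by rewrite mulr_gt0 ?ltr0n.
rewrite mulrBl mul1r divfK ?gt_eqF ?sqrtr_gt0 // lerBlDr -natrD addn2.
rewrite -[leRHS]ger0_norm ?ler0n // -sqrtr_sqr ler_wsqrtr //.
by rewrite -natrM -natrX ler_nat class_number_lower.
Unshelve. all: end_near.
Qed.
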